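(* Suppose $(f,c,\mathcal{X})$ is regular problem data and $\mathcal{A}$ is a constraint dissolving mapping for it. Let $\beta\ge 0$. Then for any $x\in\mathcal{K}$, $x$ is a first-order stationary point of (CDP) if and only if $x$ is a first-order stationary point of (NCP).
   Context: **Problem.** $\mathcal{X}\subseteq\mathbb{R}^n$ is a closed convex set, $f:\mathbb{R}^n\to\mathbb{R}$, and $c:\mathcal{Y}\to\mathbb{R}^p$ where $\mathcal{Y}\subseteq\mathbb{R}^n$ is an open set containing $\mathcal{X}$. (NCP) is the problem $\min f(x)$ subject to $c(x)=0$, $x\in\mathcal{X}$, and $\mathcal{K}:=\{x\in\mathcal{X}: c(x)=0\}$. **Notation.** $\mathcal{T}_{\mathcal{X}}(x)$, $\mathcal{N}_{\mathcal{X}}(x)$ are the tangent and normal cones of $\mathcal{X}$ at $x$; $\mathrm{aff}(\mathcal{X})$ is the affine hull; $\mathcal{E}:=\mathrm{aff}(\mathcal{X})-x$ (any $x\in\mathcal{X}$) is the associated linear subspace. $\nabla c(x)=[\nabla c_1(x),\dots,\nabla c_p(x)]\in\mathbb{R}^{n\times p}$ and $\nabla\mathcal{A}(x)=[\nabla\mathcal{A}_1(x),\dots,\nabla\mathcal{A}_n(x)]\in\mathbb{R}^{n\times n}$ are transposed Jacobians (the derivative of $\mathcal{A}$ on $\mathcal{X}$ being understood through an extension to a neighborhood of $\mathcal{X}$). $\nabla f(\mathcal{A}(x))$ means $\nabla f$ evaluated at $\mathcal{A}(x)$. For a matrix, $\mathrm{range}$ denotes its column space. **Regular problem data.** $f$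 is continuously differentiable with locally Lipschitz gradient on $\mathbb{R}^n$; $c$ is continuously differentiable with locally Lipschitz Jacobian on $\mathcal{Y}$; and there is $r>0$, independent of $x$, such that for every $x\in\mathcal{K}$ there is $\tau_x>0$ with: (a) $\dim\{\nabla c(y)^\top d: d\in\mathcal{E}\}=r$ for all $y\in\mathcal{Y}\cap\mathrm{aff}(\mathcal{X})$ with $\|y-x\|\le\tau_x$; (b) $\dim\{\nabla c(y)^\top d: d\in\mathcal{T}_{\mathcal{X}}(y)\cap-\mathcal{T}_{\mathcal{X}}(y)\}=r$ for all $y\in\mathcal{X}$ with $\|y-x\|\le\tau_x$. **Constraint dissolving mapping.** A mapping $\mathcal{A}:\mathcal{X}\to\mathbb{R}^n$ such that: (1) $\mathcal{A}$ is locally Lipschitz smooth (continuously differentiable with locally Lipschitz derivative) over $\mathcal{X}$; (2) $\mathcal{A}(x)=x$ and $\nabla\mathcal{A}(x)\nabla c(x)=0$ for all $x\in\mathcal{K}$; (3) there is a locally Lipschitz mapping $\mathcal{R}_{\mathcal{A}}:\mathcal{X}\to\mathbb{R}^{n\times n}$ with $\mathcal{R}_{\mathcal{A}}(x)=0$ for $x\in\mathcal{K}$, and for each $x\in\mathcal{K}$ there is $\omega_x>0$ such that $(\nabla\mathcal{A}(y)-I_n-\mathcal{R}_{\mathcal{A}}(y))v=0$ for all $y\in\mathcal{X}$ with $\|y-x\|\le\omega_x$ and all $v\in\mathcal{N}_{\mathcal{X}}(y)$. **(CDP).** $\min_{x\in\mathcal{X}} h(x):=f(\mathcal{A}(x))+\frac{\beta}{2}\|c(x)\|^2$,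 with penalty parameter $\beta\ge0$; here $\nabla h(x)=\nabla\mathcal{A}(x)\nabla f(\mathcal{A}(x))+\beta\nabla c(x)c(x)$. **Stationarity.** $x\in\mathcal{K}$ is a first-order stationary point of (NCP) if $0\in\nabla f(x)+\mathrm{range}(\nabla c(x))+\mathcal{N}_{\mathcal{X}}(x)$. $x\in\mathcal{X}$ is a first-order stationary point of (CDP) if $0\in\nabla h(x)+\mathcal{N}_{\mathcal{X}}(x)$. *)

(* Defs.v *)
From HB Require Import structures.
From mathcomp Require Import all_boot all_order all_algebra.
From mathcomp Require Import all_classical all_reals all_analysis.

Set Implicit Arguments.
Unset Strict Implicit.
Unset Printing Implicit Defensive.

Import Order.TTheory GRing.Theory Num.Theory.
Import numFieldNormedType.Exports.

Local Open Scope classical_set_scope.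
Local Open Scope ring_scope.

(* Vectors of R^n are row vectors, as required by the library's [jacobian].
   Since ['J F x] acts on row vectors from the right, its (i, j) entry is the
   i-th partial derivative of F_j: it is the transposed Jacobian, with the
   gradients of the components of F as columns. A product of a matrix M with a
   column vector v is thus [v *m M^T], and a product of M^T with v is [v *m M].

   The maps c : Y -> R^p and A : X -> R^n are represented by total functions.
   The values of c off the open set Y are irrelevant. The values of A off X are
   those of the extension through which the derivative of A on X is taken. *)

Section Euclidean.
Context {R : realType} {n : nat}.

Definition dot (u v : 'rV[R]_n) : R := \sum_i u 0 i * v 0 i.

(* The library norm [`|u|] on row vectors is the sup norm. *)
Definition enorm (u : 'rV[R]_n) : R := Num.sqrt (dot u u).

Definition grad (f : 'rV[R]_n -> R) (x : 'rV[R]_n) : 'rV[R]_n :=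
  \row_i 'D_(delta_mx 0 i) f x.

(* Column space of M, its elements being written as row vectors. *)
Definition range_mx (p : nat) (M : 'M[R]_(n, p)) : set 'rV[R]_n :=
  range (fun l : 'rV[R]_p => l *m M^T).

Definition has_dim (S : set 'rV[R]_n) (r : nat) : Prop :=
  exists V : {vspace 'rV[R]_n}, S = [set v | v \in V] /\ \dim V = r.

End Euclidean.

Section ConvexSets.
Context {R : realType} {n : nat}.
Implicit Types (X : set 'rV[R]_n) (x : 'rV[R]_n).

Definition aff X : set 'rV[R]_n :=
  [set y | exists (k : nat) (w : 'I_k -> R) (z : 'I_k -> 'rV[R]_n),
     [/\ forall i, X (z i), \sum_i w i = 1 & y = \sum_i w i *: z i]].

Definition aff_dir X x : set 'rV[R]_n := [set y - x | y in aff X].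

(* Tangent and normal cones of convex analysis, for convex X and x in X. *)
Definition tangent_cone X x : set 'rV[R]_n :=
  closure [set d | exists (t : R) (z : 'rV[R]_n),
                     [/\ 0 < t, X z & d = t *: (z - x)]].

Definition normal_cone X x : set 'rV[R]_n :=
  [set v | forall z, X z -> dot v (z - x) <= 0].

Definition lineality X x : set 'rV[R]_n :=
  tangent_cone X x `&` [set d | tangent_cone X x (- d)].

End ConvexSets.

(* F is continuously differentiable on D with derivative DF, and DF is locally
   Lipschitz on D. *)
Definition lipschitz_smooth (R : realType) (V W W' : normedModType R)
    (D : set V) (F : V -> W) (DF : V -> W') : Prop :=
  [/\ forall x, D x -> differentiable F x,
      {within D, continuous DF} &
      [locally [lipschitz DF x | x in D]]].

Section Problem.
Context {R : realType} {n p : nat}.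
Variables (X Y : set 'rV[R]_n).
Variables (f : 'rV[R]_n -> R) (c : 'rV[R]_n -> 'rV[R]_p).

Definition feasible : set 'rV[R]_n := [set x | X x /\ c x = 0].

Definition regular_data : Prop :=
  [/\ lipschitz_smooth setT f (grad f),
      lipschitz_smooth Y c (jacobian c) &
      exists2 r : nat, (0 < r)%N &
        forall x, feasible x -> exists2 tau : R, 0 < tau &
          (forall y, Y y -> aff X y -> enorm (y - x) <= tau ->
             has_dim [set d *m 'J c y | d in aff_dir X x] r) /\
          (forall y, X y -> enorm (y - x) <= tau ->
             has_dim [set d *m 'J c y | d in lineality X y] r)].

Definition constraint_dissolving (A : 'rV[R]_n -> 'rV[R]_n) : Prop :=
  [/\ lipschitz_smooth X A (jacobian A),
      (forall x, feasible x -> A x = x /\ 'J A x *m 'J c x = 0) &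
      exists RA : 'rV[R]_n -> 'M[R]_n,
        [/\ [locally [lipschitz RA x | x in X]],
            (forall x, feasible x -> RA x = 0) &
            forall x, feasible x -> exists2 omega : R, 0 < omega &
              forall y v, X y -> enorm (y - x) <= omega ->
                normal_cone X y v ->
                v *m ('J A y - 1%:M - RA y)^T = 0]].

Definition cdp_obj (A : 'rV[R]_n -> 'rV[R]_n) (beta : R) (x : 'rV[R]_n) : R :=
  f (A x) + beta / 2 * enorm (c x) ^+ 2.

Definition ncp_stationary (x : 'rV[R]_n) : Prop :=
  feasible x /\
  exists u v, [/\ range_mx ('J c x) u, normal_cone X x v &
                  0 = grad f x + u + v].

Definition cdp_stationary (A : 'rV[R]_n -> 'rV[R]_n) (beta : R)
    (x : 'rV[R]_n) : Prop :=
  X x /\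
  exists2 v, normal_cone X x v & 0 = grad (cdp_obj A beta) x + v.

End Problem.

(* Main.v *)
Require Import Defs.
From HB Require Import structures.
From mathcomp Require Import all_boot all_order all_algebra.
From mathcomp Require Import all_classical all_reals all_analysis.
From mathcomp Require Import ring lra.

Set Implicit Arguments.
Unset Strict Implicit.
Unset Printing Implicit Defensive.

Import Order.TTheory GRing.Theory Num.Theory.
Import numFieldNormedType.Exports.

Local Open Scope classical_set_scope.
Local Open Scope ring_scope.

(** Write [J] for the transposed Jacobian of [c] at the feasible point [x] and
  [P] for that of [A]. Since [c x = 0] and [A x = x], the gradient of the
  penalised objective at [x] is the image of [grad f x] under [P]
  ([grad_cdp_obj]), whatever [beta] is. Moreover [P] kills the range of [J] and
  fixes every vector of the normal cone.

  Applying [P] to the stationarity equation of the constrained problem yields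
  that of the penalised one. Conversely, stationarity of the penalised problem
  says that [w = grad f x + v], with [v] normal, lies in the kernel of [P], and
  it has to be shown that [w] lies in the range of [J]. Let [E] be the direction
  space of the affine hull of [X]. The crucial fact, [feasible_tangent_fixed],
  is that the transpose of [P] fixes every [d] in [E] that the derivative of [c]
  kills. Hence [w] is orthogonal to all these [d], so that [w] is the sum of an
  element of the range of [J], which [P] kills, and a vector [s] orthogonal to
  [E]. Such an [s] is a normal vector, so [P] fixes it; as [P] kills [w] and the
  other summand, [s = 0].

  The transpose of [P] fixes [d] as soon as [d] is tangent to the feasible set,
  because [A] is the identity there. Tangent directions are produced without an
  implicit function theorem. Condition (b) at [x] alone provides a point [x0] of
  the relative interior of [X] with [x0 - x] in the kernel of the derivative of
  [c] ([interior_kernel_point]), and then the same holds for [x0 + eta] for all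
  small [eta] in [E] in this kernel, so that it suffices to treat the directions
  [x0 - x]. Let [z] in [X] be near [x]. By the constant rank condition (a), the
  direction [x0 - z] can be modified by a small element of [E] into a direction
  along which the derivative of [c] at [z] vanishes, and the endpoint stays in
  [X] because [x0] is a relative interior point ([corrected_direction]). Moving
  along these directions in [N] steps of length [t / N], [c] changes by
  [O(1 / N ^ 2)] in each step, so that the polygon ends at a point of [X] close
  to [x + t (x0 - x)] at which [c] is of size [O(1 / N)]. By compactness there is a
  point of [X] equally close to [x + t (x0 - x)] at which [c] vanishes
  ([euler_polygon], [feasible_tangent]). *)

(** * Sup norm of matrices *)

Section MatrixNorm.
Context {R : realType}.

Lemma normr_mx_le (m n : nat) (M : 'M[R]_(m, n)) (a : R) :
  0 <= a -> (forall i j, `|M i j| <= a) -> `|M| <= a.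
Proof.
move=> a0 Ma; rewrite /Num.Def.normr /= mx_normrE.
by apply: (bigmax_le _ a0) => -[i j] _ /=.
Qed.

Lemma normr_mx_ge (m n : nat) (M : 'M[R]_(m, n)) i j : `|M i j| <= `|M|.
Proof.
rewrite [leRHS]/Num.Def.normr /= mx_normrE.
by apply/bigmax_geP; right; exists (i, j).
Qed.

Lemma normr_mulmx (m n p : nat) (M : 'M[R]_(m, n)) (N : 'M[R]_(n, p)) :
  `|M *m N| <= n%:R * `|M| * `|N|.
Proof.
apply: normr_mx_le => [|i j]; first by rewrite !mulr_ge0.
rewrite mxE; apply: (le_trans (ler_norm_sum _ _ _)).
rewrite -mulrA mulr_natl -[X in _ *+ X]card_ord -sumr_const.
apply: ler_sum => k _; rewrite normrM.
by apply: ler_pM => //; apply: normr_mx_ge.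
Qed.

Lemma enorm_le (n : nat) (u : 'rV[R]_n) : enorm u <= n%:R * `|u|.
Proof.
rewrite -[leRHS]ger0_norm ?mulr_ge0// -sqrtr_sqr ler_wsqrtr// /dot.
apply: (@le_trans _ _ (\sum_(i < n) `|u| ^+ 2)).
  apply: ler_sum => i _; rewrite -expr2 -real_normK ?num_real//.
  by rewrite lerXn2r ?nnegrE// normr_mx_ge.
rewrite sumr_const card_ord exprMn -[leLHS]mulr_natl.
by rewrite ler_wpM2r ?exprn_ge0// -natrX ler_nat -mulnn; case: n u => // n _; rewrite leq_pmulr.
Qed.

Lemma dot_mulmx (n : nat) (u v : 'rV[R]_n) : dot u v = (u *m v^T) 0 0.
Proof. by rewrite mxE; apply: eq_bigr => i _; rewrite mxE. Qed.

End MatrixNorm.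

(** * Rank and bounded solutions of linear systems *)

Section LinearAlgebra.

(** Translates the dimension conditions on subspaces, stated with [{vspace _}],
  into conditions on the rank of a matrix. *)
Lemma has_dim_rank (R : realType) (m n : nat) (M : 'M[R]_(m, n)) (r : nat) :
  has_dim [set v | (v <= M)%MS] r -> \rank M = r.
Proof.
move=> [V [MV <-]].
pose s := [seq row i (row_base M) | i <- enum 'I_(\rank M)].
have ss : size s = \rank M by rewrite size_map size_enum_ord.
have sE (i : 'I_(\rank M)) : s`_i = row i (row_base M).
  by rewrite (nth_map i) ?size_enum_ord// nth_ord_enum.
have -> : V = span s.
  apply/eqP; rewrite eqEsubv; apply/andP; split; last first.
    apply/span_subvP => v /mapP[i _ ->].
    have : [set v | (v <= M)%MS] (row i (row_base M)).
      by rewrite /= -(eq_row_base M) row_sub.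
    by rewrite MV.
  apply/subvP => v vV.
  have : [set v | v \in V] v by [].
  rewrite -MV /= -(eq_row_base M) => /submxP[k ->].
  rewrite mulmx_sum_row; apply: memv_suml => i _; rewrite memvZ// memv_span//.
  by apply: map_f; rewrite mem_enum.
suff /eqP -> : free (Tuple (introT eqP ss)) by rewrite ss.
apply/freeP => k /= k0 i.
have : (\row_i k i) *m row_base M = 0.
  by rewrite mulmx_sum_row -[RHS]k0; apply: eq_bigr => j _; rewrite mxE sE.
move=> /eqP; rewrite (mulmx_free_eq0 _ (row_base_free M)) => /eqP/rowP/(_ i).
by rewrite !mxE.
Qed.


(** The column space of [M] is the annihilator of its left kernel: one inclusion
  is clear, and the dimensions agree. *)
Lemma mulmx_ker_colspace (F : fieldType) (m p : nat) (M : 'M[F]_(m, p))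
    (y : 'rV[F]_m) :
  (forall u : 'rV_m, u *m M = 0 -> u *m y^T = 0) -> (y <= M^T)%MS.
Proof.
move=> My.
have yK : (y <= kermx (kermx M)^T)%MS.
  apply/sub_kermxP/trmx_inj; rewrite trmx_mul trmxK trmx0.
  apply/row_matrixP => i; rewrite row_mul row0; apply: My.
  by rewrite -row_mul mulmx_ker row0.
have MK : (M^T <= kermx (kermx M)^T)%MS.
  by apply/sub_kermxP; rewrite -trmx_mul mulmx_ker trmx0.
have [_] := mxrank_leqif_eq MK; rewrite mxrank_ker !mxrank_tr mxrank_ker.
rewrite subKn ?rank_leq_row// eqxx => /esym/andP[_ KM].
exact: submx_trans yK KM.
Qed.

(** At constant rank, linear systems have solutions that are bounded uniformly in
  the matrix. If [L *m M0 *m K] is the identity of size [\rank M0], then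
  [L *m M *m K] is still invertible for [M] near [M0], and as the rank of [M] is
  the same, the rows of [L *m M] span the whole row space of [M]. Solutions can
  thus be sought in the row space of [L]. *)
Lemma bounded_solution (R : realType) (m p : nat) (M0 : 'M[R]_(m, p)) :
  exists C g : R, [/\ 0 <= C, 0 < g & forall (M : 'M[R]_(m, p)) (v : 'rV[R]_p),
    `|M - M0| <= g -> \rank M = \rank M0 -> (v <= M)%MS ->
    exists2 q : 'rV[R]_m, q *m M = v & `|q| <= C * `|v|].
Proof.
pose r := \rank M0.
have [L [K LK]] : exists (L : 'M[R]_(r, m)) (K : 'M[R]_(p, r)), L *m M0 *m K = 1%:M.
  have /row_freeP[K BK] := row_base_free M0.
  have /row_fullP[L LC] := col_base_full M0.
  exists L, K; rewrite -[X in _ *m X *m _](mulmx_base M0) mulmxA LC mul1mx.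
  exact: BK.
pose a := 2 * r%:R * (p%:R * (m%:R * `|L|)) * `|K| + 1.
have a0 : 0 < a by rewrite ltr_wpDl// !mulr_ge0.
pose C := 2 * p%:R * `|K| * r%:R * `|L|.
exists C, a^-1; split; [by rewrite !mulr_ge0|by rewrite invr_gt0|].
move=> M v Mg rM vM.
pose S := L *m M *m K.
have S1 : `|S - 1%:M| * r%:R <= 2^-1.
  rewrite -LK /S -mulmxBl -mulmxBr.
  have h1 := normr_mulmx (L *m (M - M0)) K.
  have h2 := normr_mulmx L (M - M0).
  apply: (@le_trans _ _ (p%:R * (m%:R * `|L| * a^-1) * `|K| * r%:R)).
    rewrite ler_wpM2r//; apply: (le_trans h1); rewrite ler_wpM2r// ler_wpM2l//.
    by apply: (le_trans h2); rewrite ler_wpM2l ?mulr_ge0.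
  have -> : p%:R * (m%:R * `|L| * a^-1) * `|K| * r%:R = (a - 1) / a / 2.
    by rewrite /a; field; rewrite -/a gt_eqF.
  by rewrite ler_pdivrMr// mulVf// ler_pdivrMr// mul1r lerBlDr lerDl.
(* S is within 1/2 of the identity in operator norm, hence bounded below *)
have Sbd (b : 'rV[R]_r) : `|b| <= 2 * `|b *m S|.
  have : `|b| <= `|b *m S| + `|b *m (S - 1%:M)|.
    by rewrite mulmxBr mulmx1 -[X in `|X| <= _](subKr (b *m S)) ler_normB.
  have := normr_mulmx b (S - 1%:M).
  have : `|b| * (`|S - 1%:M| * r%:R) <= `|b| * 2^-1 by rewrite ler_wpM2l.
  move: `|S - 1%:M| `|b| => s t; lra.
have Sfree : row_free S.
  apply/inj_row_free => b bS; apply/eqP; rewrite -normr_le0.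
  by apply: (le_trans (Sbd b)); rewrite bS normr0 mulr0.
have vLM : (v <= L *m M)%MS.
  apply: (submx_trans vM).
  have rLM : \rank (L *m M) = \rank M.
    apply/eqP; rewrite eqn_leq mxrankM_maxr rM.
    by move: Sfree => /eqP rS; rewrite -{1}[\rank M0]rS mxrankM_maxl.
  by have [_ /esym] := mxrank_leqif_eq (submxMl L M); rewrite rLM eqxx => /andP[].
have [b vE] := submxP vLM.
exists (b *m L); first by rewrite -mulmxA.
have h1 := normr_mulmx b L.
have h2 := normr_mulmx v K.
have h3 : `|b| <= 2 * (p%:R * `|v| * `|K|).
  apply: (le_trans (Sbd b)); rewrite ler_wpM2l//.
  by rewrite /S !mulmxA in h2 *; rewrite -[b *m L *m M]mulmxA -vE.
apply: (le_trans h1).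
apply: (@le_trans _ _ (r%:R * (2 * (p%:R * `|v| * `|K|)) * `|L|)).
  by rewrite ler_wpM2r// ler_wpM2l.
by rewrite le_eqVlt; apply/orP; left; apply/eqP; rewrite /C; ring.
Qed.

End LinearAlgebra.

(** * Relative interior of a convex set *)

Section ConvexGeometry.
Context {R : realType} {n : nat}.
Implicit Types (X : set 'rV[R]_n) (x : 'rV[R]_n).

Lemma convex_set_comb X x y (t : R) : convex_set X -> X x -> X y ->
  0 <= t -> t <= 1 -> X (t *: x + (1 - t) *: y).
Proof.
move=> cX Xx Xy t0 t1.
have := cX x y (Itv01 t0 t1) (mem_set Xx) (mem_set Xy).
by rewrite inE.
Qed.

Lemma convex_set_simplex X x (k : nat) (w : 'I_k -> R) (b : 'I_k -> 'rV[R]_n) :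
  convex_set X -> X x -> (forall i, X (x + b i)) -> (forall i, 0 <= w i) ->
  \sum_i w i <= 1 -> X (x + \sum_i w i *: b i).
Proof.
move=> cX Xx; elim: k w b => [|k IH] w b Xb w0 w1; first by rewrite big_ord0 addr0.
move: w1; rewrite !big_ord_recr/=.
set s := \sum_(i < k) _; set l := w _ => w1.
have s0 : 0 <= s by apply: sumr_ge0.
have l0 : 0 <= l by apply: w0.
have [l1|l1] := eqVneq l 1.
  have : s == 0 by rewrite eq_le s0 andbT; lra.
  rewrite psumr_eq0// => /allP wi0; rewrite big1 ?add0r ?l1 ?scale1r//.
  by move=> i _; move: (wi0 i); rewrite mem_index_enum => /(_ isT)/= /eqP ->; rewrite scale0r.
have l1' : 0 < 1 - l by rewrite subr_gt0 lt_neqAle l1; lra.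
have Xs : X (x + \sum_(i < k) (w (widen_ord (leqnSn k) i) / (1 - l)) *:
    b (widen_ord (leqnSn k) i)).
  apply: IH => // [i|]; first by rewrite divr_ge0// ltW.
  by rewrite -mulr_suml -/s ler_pdivrMr// mul1r; lra.
have := convex_set_comb cX (Xb ord_max) Xs l0 ltac:(lra).
congr (X _); rewrite -/l !scalerDr scaler_sumr addrACA -scalerDl [l + (1 - l)]addrC subrK scale1r.
congr (_ + _); rewrite addrC; congr (_ + _).
by apply: eq_bigr => i _; rewrite scalerA mulrCA divff ?gt_eqF// mulr1.
Qed.

(** The rows of [B] are a basis of the direction space of the affine hull of [X]:
  a linearly independent family of vectors [z - x], with [z] in [X], that has
  maximal size. *)
Lemma affine_frame X x : X x -> exists (m : nat) (B : 'M[R]_(m, n)),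
  [/\ row_free B, forall i, X (x + row i B) & forall z, X z -> (z - x <= B)%MS].
Proof.
move=> Xx.
pose P (m : nat) := `[< exists B : 'M[R]_(m, n), row_free B /\ forall i, X (x + row i B) >].
have P0 : exists m, P m.
  exists 0; apply/asboolP; exists 0; split; last by case.
  by rewrite /row_free mxrank0.
have Pn m : P m -> (m <= n)%N.
  by move=> /asboolP[B [/eqP rB _]]; rewrite -rB rank_leq_col.
case: (ex_maxnP P0 Pn) => m /asboolP[B [Bfree BX]] mmax.
exists m, B; split => // z Xz; apply/negPn/negP => zB.
suff /mmax : P (m + 1)%N by rewrite addn1 ltnn.
apply/asboolP; exists (col_mx B (z - x)); split; last first.
  move=> i; rewrite -[i]splitK; case: (fintype.split i) => j /=.
    by rewrite rowKu.
  by rewrite rowKd row_id addrC subrK.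
rewrite /row_free -addsmxE mxrank_disjoint_sum.
  move: Bfree => /eqP ->; rewrite eqn_add2l rank_rV.
  by case: (eqVneq (z - x) 0) => // z0; move: zB; rewrite z0 sub0mx.
apply/row_matrixP => i; rewrite row0.
have := row_sub i (B :&: (z - x))%MS; move: (row i _) => v.
rewrite sub_capmx => /andP[+ /sub_rVP[a va]]; rewrite va.
have [->|a0] := eqVneq a 0; first by rewrite scale0r.
by rewrite (eqmx_scale (z - x) a0) (negPf zB).
Qed.

(** The barycentre of the simplex with vertices [x] and [x + row i B] is a
  relative interior point: a small [eta] in the row space of [B] has small
  coordinates in the basis [B], and adding these to the weights of the
  barycentre leaves them nonnegative with sum at most 1. *)
Lemma relative_interior X x (m : nat) (B : 'M[R]_(m, n)) :
  convex_set X -> X x -> row_free B -> (forall i, X (x + row i B)) ->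
  exists2 xh, X xh /\ (xh - x <= B)%MS & exists2 rho : R, 0 < rho &
    forall eta, (eta <= B)%MS -> `|eta| <= rho -> X (xh + eta).
Proof.
move=> cX Xx Bfree BX.
(* the common weight of the m + 1 vertices *)
pose w : R := (m.+1%:R)^-1.
have w0 : 0 < w by rewrite invr_gt0 ltr0Sn.
have wm : w * m%:R = 1 - w by rewrite /w -natr1; field; rewrite natr1 pnatr_eq0.
pose xh := x + const_mx w *m B.
pose a := n%:R * `|pinvmx B| + 1.
have a0 : 0 < a by rewrite ltr_wpDl// mulr_ge0.
(* w ^ 2 bounds the coordinates of eta, since m (w + w ^ 2) = 1 - w ^ 2 <= 1 *)
pose rho := w ^+ 2 / a.
have rho0 : 0 < rho by rewrite divr_gt0// exprn_gt0.
have Xxh eta : (eta <= B)%MS -> `|eta| <= rho -> X (xh + eta).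
  move=> etaB etar.
  have /eqP := mulmxKpV etaB; set u := eta *m pinvmx B => /eqP uB.
  have ui i : `|u 0 i| <= w ^+ 2.
    apply: (le_trans (normr_mx_ge u 0 i)); apply: (le_trans (normr_mulmx _ _)).
    apply: (@le_trans _ _ (rho * (n%:R * `|pinvmx B|))).
      by rewrite mulrAC mulrC ler_wpM2r// mulr_ge0.
    apply: (@le_trans _ _ (rho * a)); first by rewrite ler_wpM2l ?(ltW rho0)// lerDl.
    by rewrite /rho divfK ?gt_eqF.
  clearbody u; rewrite /xh -addrA -uB -mulmxDl mulmx_sum_row.
  have w2 : w ^+ 2 <= w by rewrite expr2 ler_piMl ?(ltW w0)// invf_le1 ?ltr0Sn// ler1n.
  apply: convex_set_simplex => // [i|].
    by rewrite !mxE; move: (ui i); rewrite ler_norml => /andP[]; lra.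
  apply: (@le_trans _ _ (\sum_(i < m) (w + w ^+ 2))).
    by apply: ler_sum => i _; rewrite !mxE lerD2l (le_trans (ler_norm _)).
  rewrite sumr_const card_ord -mulr_natr.
  have -> : (w + w ^+ 2) * m%:R = w * m%:R + w * (w * m%:R) by ring.
  by rewrite wm; have := sqr_ge0 w; nra.
exists xh.
  split; first by rewrite -[xh]addr0; apply: Xxh; rewrite ?sub0mx// normr0 ltW.
  by rewrite /xh addrC addKr submxMl.
by exists rho.
Qed.

End ConvexGeometry.

(** * First-order estimates *)

Section FirstOrder.
Context {R : realType} {n p : nat}.
Implicit Types (F : 'rV[R]_n -> 'rV[R]_p) (x z d : 'rV[R]_n).

Lemma differentiable_expansion F x (e : R) : differentiable F x -> 0 < e ->
  exists2 del : R, 0 < del & forall h, `|h| <= del ->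
    `|F (x + h) - F x - h *m 'J F x| <= e * `|h|.
Proof.
move=> dF e0.
have /eqaddoP/(_ e e0)/nbhs_ballP[del /= del0 H] := diff_locally dF.
exists (del / 2); first by rewrite divr_gt0.
move=> h hdel.
have /H /= : ball 0 del h.
  by rewrite -ball_normE /ball_/= sub0r normrN; move: hdel del0; lra.
by rewrite /jacobian mul_rV_lin1 -addrA -opprD [x + h]addrC; exact.
Qed.

Lemma is_derive_line F z d (s : R) (j : 'I_p) :
  differentiable F (z + s *: d) ->
  is_derive s 1 (fun s : R => F (z + s *: d) 0 j) ((d *m 'J F (z + s *: d)) 0 j).
Proof.
move=> dF.
pose l (s : R) := z + s *: d.
have dl : is_diff s l (fun h : R => 0 + h *: d) by apply: is_diffD.
have dFl : differentiable (F \o l) s by apply: differentiable_comp.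
have DFl : 'D_1 (F \o l) s = d *m 'J F (z + s *: d).
  rewrite deriveE// diff_comp//= diff_val add0r scale1r.
  by rewrite /jacobian mul_rV_lin1.
have derFl : derivable (F \o l) s 1 by exact: diff_derivable.
apply: DeriveDef; first by move/derivable_mxP : derFl; apply.
by rewrite -DFl derive_mx// mxE.
Qed.

(** The mean value theorem is applied to each component of [F] along the segment;
  the intermediate point depends on the component, hence a sup norm bound. *)
Lemma mean_value_le F z d (K : R) :
  (forall s : R, 0 <= s <= 1 -> differentiable F (z + s *: d)) ->
  (forall s : R, 0 <= s <= 1 -> `|'J F (z + s *: d) - 'J F z| <= K) ->
  `|F (z + d) - F z - d *m 'J F z| <= n%:R * `|d| * K.
Proof.
move=> dF JF.
have K0 : 0 <= K by apply: le_trans (JF 0 _); rewrite ?lexx ?ler01.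
apply: normr_mx_le => [|i j]; first by rewrite !mulr_ge0.
rewrite ord1.
pose phi (s : R) := F (z + s *: d) 0 j.
pose dphi (s : R) := (d *m 'J F (z + s *: d)) 0 j.
have der (s : R) : 0 <= s <= 1 -> is_derive s 1 phi (dphi s).
  by move=> /dF; exact: is_derive_line.
have [s s01] : exists2 s : R, s \in `[0, 1] & phi 1 - phi 0 = dphi s * (1 - 0).
  apply: MVT_segment => //.
    by move=> s; rewrite in_itv/= => /andP[s0 s1]; apply: der; rewrite !ltW.
  apply: derivable_within_continuous => s; rewrite in_itv/= => s01.
  by have [] := der s s01.
rewrite /phi /dphi scale1r scale0r addr0 subr0 mulr1 => E.
have -> : (F (z + d) - F z - d *m 'J F z) 0 j = (d *m ('J F (z + s *: d) - 'J F z)) 0 j.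
  by rewrite mulmxBr [RHS]mxE -E !mxE.
apply: (le_trans (normr_mx_ge _ _ _)); apply: (le_trans (normr_mulmx _ _)).
by rewrite ler_wpM2l ?mulr_ge0//; apply: JF; move: s01; rewrite in_itv.
Qed.

(** The local Lipschitz condition is phrased with a filter on pairs of points;
  this extracts a constant and a radius from it, at a pair on the diagonal. *)
Lemma lipschitz_on_locally (W : normedModType R) (Y : set 'rV[R]_n)
    (J : 'rV[R]_n -> W) x :
  open Y -> [locally [lipschitz J x | x in Y]] -> Y x ->
  exists L g : R, [/\ 0 <= L, 0 < g, forall y, `|y - x| <= g -> Y y &
    forall y z, `|y - x| <= g -> `|z - x| <= g -> `|J y - J z| <= L * `|y - z|].
Proof.
move=> oY lJ Yx.
have := lJ (x, x) (conj Yx Yx).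
rewrite /lipschitz_on /dominated_by => /pinfty_ex_gt0[L L0].
rewrite /within /= => /nbhs_ballP[e e0 He].
have /nbhs_ballP[e' e'0 He'] : nbhs x Y by exact: open_nbhs_nbhs.
pose g := Num.min e e' / 2.
have g0 : 0 < Num.min e e' by rewrite lt_min e0 e'0.
have gg : g < Num.min e e' by rewrite /g; lra.
have gball y : `|y - x| <= g -> ball x e y /\ ball x e' y.
  move=> yg; rewrite -!ball_normE /ball_/= distrC.
  by have := le_lt_trans yg gg; rewrite lt_min => /andP.
exists L, g; split.
- exact: ltW.
- by rewrite divr_gt0.
- by move=> y /gball[_ /He'].
move=> y z yg zg; have [ye ye'] := gball y yg; have [ze ze'] := gball z zg.
have := He (y, z) (conj ye ze); rewrite /= => /(_ (conj (He' _ ye') (He' _ ze'))).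
done.
Qed.

End FirstOrder.

(** * Euler polygons *)

Section EulerPolygon.
Context {R : realType} {n p : nat}.

Lemma le0_invn (a b : R) : (forall N : nat, a <= b / N.+1%:R) -> a <= 0.
Proof.
move=> ab; rewrite leNgt; apply/negP => a0.
have b0 : 0 < b by have := ab 0; rewrite divr1; apply: lt_le_trans.
have := archi_boundP (ltW (divr_gt0 b0 a0)).
set N := Num.bound _; have := ab N; rewrite ler_pdivlMr ?ltr0Sn// => aN.
rewrite ltr_pdivrMr// => bN.
by move: aN; rewrite -natr1 mulrDr mulr1; lra.
Qed.

(** With [N.+1] steps of length [h = t / N.+1], the errors [K h ^ 2] committed on
  [c] add up to [K t ^ 2 / N.+1], while the deviation from the straight line
  stays below [t e] independently of [N]. A minimiser of [`|c _|] over the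
  compact set of points of [X] within [t e] of [x + t *: d0] is therefore a zero
  of [c]. *)
Lemma euler_polygon (X : set 'rV[R]_n) (c : 'rV[R]_n -> 'rV[R]_p)
    (x d0 : 'rV[R]_n) (t e K : R) :
  closed X -> {in X, continuous c} -> X x -> c x = 0 -> 0 <= t -> 0 <= e ->
  (forall z, X z -> `|z - x| <= t * (`|d0| + e) ->
    exists2 d, `|d - d0| <= e & forall h, 0 <= h <= t ->
      X (z + h *: d) /\ `|c (z + h *: d) - c z| <= K * h ^+ 2) ->
  exists z, [/\ X z, `|z - (x + t *: d0)| <= t * e & c z = 0].
Proof.
move=> cX cc Xx cx0 t0 e0 step.
have poly (N : nat) : exists z, [/\ X z, `|z - (x + t *: d0)| <= t * e &
    `|c z| <= K * t ^+ 2 / N.+1%:R].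
  pose h := t / N.+1%:R.
  have h0 : 0 <= h by rewrite divr_ge0.
  have hN : N.+1%:R * h = t by rewrite mulrC divfK ?pnatr_eq0.
  have H (k : nat) : (k <= N.+1)%N -> exists z, [/\ X z,
      `|z - (x + (k%:R * h) *: d0)| <= k%:R * h * e & `|c z| <= k%:R * (K * h ^+ 2)].
    elim: k => [_|k IH kN].
      by exists x; rewrite !mul0r scale0r addr0 subrr cx0 !normr0.
    have [z [Xz zk cz]] := IH (ltnW kN).
    have kt : k%:R * h <= t by rewrite -hN ler_wpM2r// ler_nat ltnW.
    have kh0 : 0 <= k%:R * h by rewrite mulr_ge0.
    have zx : `|z - x| <= t * (`|d0| + e).
      have -> : z - x = (z - (x + (k%:R * h) *: d0)) + (k%:R * h) *: d0.
        by rewrite opprD addrA subrK.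
      apply: (le_trans (ler_normD _ _)); rewrite normrZ ger0_norm// addrC mulrDr.
      by apply: lerD; [rewrite ler_wpM2r|apply: (le_trans zk); rewrite ler_wpM2r].
    have [d dd0 /(_ h)] := step z Xz zx.
    have ht : 0 <= h <= t.
      by rewrite h0 -hN ler_peMl// ler1n.
    move=> /(_ ht)[Xzh czh].
    exists (z + h *: d); split => //.
    - have -> : z + h *: d - (x + (k.+1%:R * h) *: d0) =
          (z - (x + (k%:R * h) *: d0)) + h *: (d - d0).
        rewrite -natr1 mulrDl mul1r scalerDl scalerBr !opprD !addrA.
        rewrite -!addrA; congr (_ + _); rewrite addrC -!addrA; congr (_ + _).
        by rewrite addrCA addrC -addrA.
      apply: (le_trans (ler_normD _ _)); rewrite normrZ ger0_norm//.
      rewrite -natr1 mulrDl mul1r mulrDl; apply: lerD => //.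
      by rewrite ler_wpM2l.
    - rewrite -[c _](subrK (c z)) (le_trans (ler_normD _ _))// -natr1 mulrDl mul1r addrC.
      exact: lerD.
  have [z [Xz zt cz]] := H N.+1 (leqnn _).
  exists z; split => //; first by rewrite hN in zt.
  apply: (le_trans cz); rewrite le_eqVlt; apply/orP; left; apply/eqP.
  by rewrite /h; field; rewrite addrC natr1 pnatr_eq0.
pose S := X `&` closed_ball_ Num.Def.normr (x + t *: d0) (t * e).
have SE z : S z <-> X z /\ `|z - (x + t *: d0)| <= t * e.
  by rewrite /S /setI /closed_ball_/= distrC.
have S0 : S !=set0 by have [z [Xz zt _]] := poly 0; exists z; apply/SE.
have cS : compact S.
  apply: bounded_closed_compact; last by apply: closedI => //; apply: closed_closed_ball_.
  exists (`|x + t *: d0| + t * e); split; first exact: num_real.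
  move=> M Mlt z /SE[_ zt]; rewrite -[z](subrK (x + t *: d0)) addrC.
  by apply: (le_trans (ler_normD _ _)); apply: ltW; apply: le_lt_trans Mlt; rewrite lerD2l.
have ccS : {within S, continuous (fun z => `|c z|)}.
  apply: continuous_in_subspaceT => z; rewrite inE => -[Xz _].
  by apply: continuous_comp; [apply: cc; rewrite inE|exact: norm_continuous].
have [z + zmin] := compact_EVT_min S0 cS ccS.
rewrite inE => /SE[Xz zt]; exists z; split => //.
apply/eqP; rewrite -normr_le0; apply: (@le0_invn _ (K * t ^+ 2)) => N.
have [y [Xy yt cy]] := poly N.
by apply: le_trans cy; apply: zmin; rewrite inE; apply/SE.
Qed.

End EulerPolygon.

(** * Tangent directions of the feasible set *)

(** [B] spans the direction space of the affine hull of [X], and [x0] is a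
  relative interior point of [X] such that the derivative of [c] at [x] vanishes
  in the direction [x0 - x]. The Jacobian of [c] is kept as a variable [J]: were
  it a concrete term, unification would unfold it down to the definition of the
  differential. *)
Section FeasibleSet.
Context {R : realType} {n p m : nat}.
Variables (X Y : set 'rV[R]_n) (c : 'rV[R]_n -> 'rV[R]_p).
Variable J : 'rV[R]_n -> 'M[R]_(n, p).
Variables (x : 'rV[R]_n) (B : 'M[R]_(m, n)) (x0 : 'rV[R]_n) (rho tau : R).
Hypothesis X_closed : closed X.
Hypothesis X_convex : convex_set X.
Hypothesis Y_open : open Y.
Hypothesis XY : X `<=` Y.
Hypothesis JE : forall z, 'J c z = J z.
Hypothesis c_smooth : lipschitz_smooth Y c J.
Hypothesis Kx : feasible X c x.
Hypothesis B_span : forall z, X z -> (z - x <= B)%MS.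
Hypothesis tau_gt0 : 0 < tau.
Hypothesis constant_rank : forall z, X z -> `|z - x| <= tau ->
  \rank (B *m J z) = \rank (B *m J x).
Hypothesis rho_gt0 : 0 < rho.
Hypothesis x0_B : (x0 - x <= B)%MS.
Hypothesis x0_interior :
  forall eta, (eta <= B)%MS -> `|eta| <= rho -> X (x0 + eta).
Hypothesis x0_kernel : (x0 - x) *m J x = 0.

(** The defect [v = (x0 - z) *m J z] is small because it vanishes at [z = x]. By
  constant rank it is the image of a small vector [q *m B], which is subtracted
  from [x0 - z]; as [x0] is a relative interior point, the new endpoint
  [x0 - q *m B] is still in [X]. *)
Lemma corrected_direction (e : R) : 0 < e ->
  exists2 del : R, 0 < del & forall z, X z -> `|z - x| <= del ->
    exists d, [/\ `|d - (x0 - x)| <= e, d *m J z = 0 & X (z + d)].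
Proof.
move=> e0.
have [_ _ lipJ] := c_smooth; have [Xx _] := Kx.
have [L [g [L0 g0 _ JL]]] := lipschitz_on_locally Y_open lipJ (XY Xx).
have [C [gam [C0 gam0 sol]]] := bounded_solution (B *m J x).
pose V := n%:R * `|x0 - x| * L + n%:R * (`|J x| + L).
have V0 : 0 <= V by rewrite addr_ge0 ?mulr_ge0// addr_ge0.
pose Q := m%:R * (C * V) * `|B|.
have Q0 : 0 <= Q by rewrite !mulr_ge0.
pose S := n%:R * `|B| * L.
have S0 : 0 <= S by rewrite !mulr_ge0.
pose del := Num.min 1 (Num.min g (Num.min tau
  (Num.min (gam / (S + 1)) (Num.min (rho / (Q + 1)) (e / (Q + 1)))))).
exists del.
  by rewrite !lt_min ltr01 g0 tau_gt0 !divr_gt0// ltr_wpDl.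
move=> z Xz; set s := `|z - x|.
have s0 : 0 <= s by rewrite /s.
rewrite !le_min => /and5P[s1 sg stau + /andP[+ +]].
rewrite !ler_pdivlMr ?ltr_wpDl// !mulrDr !mulr1 => sgam srho se.
have Jzx : `|J z - J x| <= L * s by apply: JL; rewrite // subrr normr0 ltW.
have zB : (x0 - z <= B)%MS.
  have -> : x0 - z = (x0 - x) - (z - x) by rewrite opprB addrA subrK.
  by rewrite addmx_sub// eqmx_opp B_span.
pose v := (x0 - z) *m J z.
have vs : `|v| <= s * V.
  have -> : v = (x0 - x) *m (J z - J x) + (x - z) *m J z.
    by rewrite mulmxBr x0_kernel subr0 -mulmxDl addrA subrK.
  have h1 := normr_mulmx (x0 - x) (J z - J x).
  have h2 := normr_mulmx (x - z) (J z).
  have h3 : `|J z| <= `|J x| + L.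
    rewrite -[J z](subrK (J x)) addrC (le_trans (ler_normD _ _))//.
    by rewrite lerD2l (le_trans Jzx)// ler_piMr.
  rewrite distrC -/s in h2.
  apply: (le_trans (ler_normD _ _)).
  have -> : s * V = n%:R * `|x0 - x| * (L * s) + n%:R * s * (`|J x| + L).
    by rewrite /V; ring.
  apply: lerD; first by apply: (le_trans h1); rewrite ler_wpM2l ?mulr_ge0.
  by apply: (le_trans h2); rewrite ler_wpM2l ?mulr_ge0.
have [q qv qC] : exists2 q, q *m (B *m J z) = v & `|q| <= C * `|v|.
  apply: sol; first 1 last.
  - exact: constant_rank.
  - exact: submxMr.
  rewrite -mulmxBr; apply: (le_trans (normr_mulmx _ _)).
  apply: (@le_trans _ _ (s * S)); last by lra.
  have -> : s * S = n%:R * `|B| * (L * s) by rewrite /S; ring.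
  by rewrite ler_wpM2l// mulr_ge0.
have qQ : `|q *m B| <= s * Q.
  apply: (le_trans (normr_mulmx _ _)).
  have -> : s * Q = m%:R * (C * (s * V)) * `|B| by rewrite /Q; ring.
  rewrite ler_wpM2r// ler_wpM2l// (le_trans qC)// ler_wpM2l//.
exists (x0 - z - q *m B); split.
- have -> : x0 - z - q *m B - (x0 - x) = (x - z) - q *m B.
    by rewrite opprB addrAC; congr (_ - _); rewrite addrC addrA subrK.
  by apply: (le_trans (ler_normB _ _)); rewrite distrC -/s; lra.
- by rewrite mulmxBl -/v -mulmxA qv subrr.
- rewrite addrA [z + _]addrC subrK; apply: x0_interior.
    by rewrite eqmx_opp submxMl.
  by rewrite normrN; lra.
Qed.

(** Every convex combination of [z] and the endpoint [z + d] of a corrected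
  direction is in [X], and [c] changes only to second order along it since its
  Jacobian is Lipschitz and vanishes on [d] at [z]. *)
Lemma feasible_tangent (e : R) : 0 < e ->
  exists2 t0 : R, 0 < t0 & forall t, 0 <= t <= t0 ->
    exists z, `|z - (x + t *: (x0 - x))| <= t * e /\ feasible X c z.
Proof.
move=> e0.
have [c_diff _ lipJ] := c_smooth; have [Xx cx0] := Kx.
have [L [g [L0 g0 gY JL]]] := lipschitz_on_locally Y_open lipJ (XY Xx).
have [del del0 dir] := corrected_direction e0.
set d0 := x0 - x in dir *.
pose D := `|d0| + e; have D0 : 0 < D by rewrite ltr_wpDl.
pose t0 := Num.min 1 (Num.min (del / D) (g / (D + D))).
exists t0; first by rewrite !lt_min ltr01 !divr_gt0// addr_gt0.
move=> t /andP[t_ge0]; rewrite !le_min => /and3P[t1].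
rewrite !ler_pdivlMr ?(addr_gt0 D0 D0)// => tdel tg.
have [z [Xz zt cz]] : exists z, [/\ X z, `|z - (x + t *: d0)| <= t * e & c z = 0].
  apply: (@euler_polygon _ _ _ _ _ _ _ _ _ (n%:R * D * (L * D))) => //.
  - move=> z; rewrite inE => /XY Yz; exact/differentiable_continuous/c_diff.
  - exact: ltW.
  move=> z Xz; rewrite -/D => zt.
  have [d [dd0 dJ Xzd]] := dir z Xz (le_trans zt tdel).
  exists d => // h /andP[h0 ht].
  have dD : `|d| <= D.
    rewrite -[d](subrK d0) addrC (le_trans (ler_normD _ _))//.
    by rewrite lerD2l.
  have hD : `|h *: d| <= h * D by rewrite normrZ ger0_norm// ler_wpM2l.
  have hDt : h * D <= t * D by rewrite ler_wpM2r// ltW.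
  split.
    have -> : z + h *: d = h *: (z + d) + (1 - h) *: z.
      by rewrite scalerDr addrAC -scalerDl [h + _]addrC subrK scale1r.
    by apply: convex_set_comb => //; apply: le_trans t1.
  have shD (s : R) : 0 <= s <= 1 -> `|s *: (h *: d)| <= h * D.
    move=> /andP[s0 s1]; rewrite normrZ ger0_norm//.
    by apply: le_trans hD; rewrite ler_piMl.
  have near_x (s : R) : 0 <= s <= 1 -> `|z + s *: (h *: d) - x| <= g.
    move=> s01; rewrite addrAC (le_trans (ler_normD _ _))//.
    by have := shD s s01; move: tg; rewrite mulrDr; lra.
  have := @mean_value_le _ _ _ c z (h *: d) (L * (h * D)).
  rewrite !JE -scalemxAl dJ scaler0 subr0 => mv.
  apply: (le_trans (mv _ _)).
  - by move=> s s01; apply: c_diff; apply: gY; apply: near_x.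
  - move=> s s01; rewrite !JE; apply: (le_trans (JL _ _ (near_x s s01) _)).
      by move: tg; rewrite mulrDr; have := le_trans h0 ht; move: D0 zt; nra.
    by rewrite [z + _]addrC addrK ler_wpM2l// shD.
  have -> : n%:R * D * (L * D) * h ^+ 2 = n%:R * (h * D) * (L * (h * D)) by ring.
  rewrite ler_wpM2r// ?ler_wpM2l//.
  by rewrite !mulr_ge0// ltW.
by exists z.
Qed.

(** Along feasible points [z] that approach [x] in the direction [x0 - x], the
  first-order expansion of [A] at [x] must reproduce [A z - A x = z - x]. *)
Lemma fixed_direction (A : 'rV[R]_n -> 'rV[R]_n) :
  differentiable A x -> (forall z, feasible X c z -> A z = z) ->
  (x0 - x) *m 'J A x = x0 - x.
Proof.
move=> dA AK; apply/eqP; rewrite -subr_eq0 -normr_le0.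
set d0 := x0 - x; pose D := `|d0| + 1.
have D0 : 0 < D by rewrite ltr_wpDl.
apply: (@le0_invn _ _ (D + (1 + n%:R * `|'J A x|))) => N.
pose e : R := N.+1%:R^-1.
have e0 : 0 < e by rewrite invr_gt0 ltr0Sn.
have e1 : e <= 1 by rewrite invf_le1 ?ltr0Sn// ler1n.
have [t0 t0_gt0 tang] := feasible_tangent e0.
have [del del0] := differentiable_expansion dA e0.
move: ('J A x) => JA expA0.
pose t := Num.min t0 (del / D).
have tgt0 : 0 < t by rewrite lt_min t0_gt0 divr_gt0.
have [z [zt Kz]] : exists z, `|z - (x + t *: d0)| <= t * e /\ feasible X c z.
  by apply: tang; rewrite ltW//= ge_min lexx.
set r := z - _ in zt; pose h := z - x.
have hE : h = t *: d0 + r by rewrite /r opprD [RHS]addrC addrA subrK.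
have hD : `|h| <= t * D.
  rewrite hE (le_trans (ler_normD _ _))// normrZ gtr0_norm// mulrDr lerD2l.
  by apply: (le_trans zt); rewrite ler_wpM2l// ltW.
have := expA0 h.
rewrite (_ : x + h = z); last by rewrite addrC subrK.
rewrite (AK z Kz) (AK x Kx) -/h => expA.
have {}expA : `|h - h *m JA| <= e * (t * D).
  apply: (le_trans (expA _)); last by rewrite ler_wpM2l// ltW.
  by apply: (le_trans hD); rewrite -ler_pdivlMr// ge_min lexx orbT.
have rJ : `|r *m JA - r| <= t * e * (1 + n%:R * `|JA|).
  apply: (le_trans (ler_normB _ _)); have := normr_mulmx r JA => rJ.
  rewrite mulrDr mulr1 addrC; apply: lerD => //; apply: (le_trans rJ).
  have -> : t * e * (n%:R * `|JA|) = n%:R * (t * e) * `|JA| by ring.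
  by rewrite ler_wpM2r// ler_wpM2l.
have E : t *: (d0 *m JA - d0) = - (h - h *m JA) - (r *m JA - r).
  rewrite hE [(_ + r) *m _]mulmxDl -scalemxAl scalerBr.
  move: (t *: d0) (t *: (d0 *m JA)) (r *m JA) => u v w.
  by apply/rowP => i; rewrite !mxE; ring.
have : t * `|d0 *m JA - d0| <= t * (e * (D + (1 + n%:R * `|JA|))).
  rewrite -[X in X * _]gtr0_norm// -normrZ E.
  apply: (le_trans (ler_normB _ _)); rewrite normrN.
  by rewrite [leRHS](_ : _ = e * (t * D) + t * e * (1 + n%:R * `|JA|)); [exact: lerD|ring].
by rewrite ler_pM2l// mulrC.
Qed.

End FeasibleSet.

(** * Consequences of the dimension conditions *)

Section TangentCone.
Context {R : realType} {n m : nat}.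
Variables (X : set 'rV[R]_n) (x : 'rV[R]_n) (B : 'M[R]_(m, n)).
Hypothesis X_convex : convex_set X.
Hypothesis Xx : X x.
Hypothesis B_X : forall i, X (x + row i B).
Hypothesis B_span : forall z, X z -> (z - x <= B)%MS.

(** A vector [u *m B] is a combination of the rows of [B], and [x + u *m B] is the
  affine combination of the points [x + row i B] with weights [u 0 i] and of [x]
  with the remaining weight. *)
Lemma aff_dirE : aff_dir X x = [set d | (d <= B)%MS].
Proof.
apply/seteqP; split=> d /=.
  move=> [y [k [w [z [Xz w1 ->]]]] <-].
  have -> : \sum_i w i *: z i - x = \sum_i w i *: (z i - x).
    under [RHS]eq_bigr do rewrite scalerBr.
    by rewrite sumrB -scaler_suml w1 scale1r.
  by apply: summx_sub => i _; apply/scalemx_sub/B_span.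
move=> /submxP[u ->]; exists (x + u *m B); last by rewrite addrC addKr.
pose s := \sum_j u 0 j.
exists m.+1, (fun i => oapp (u 0) (1 - s) (unlift ord0 i)),
  (fun i => oapp (fun j => x + row j B) x (unlift ord0 i)); split.
- by move=> i; case: unliftP => [j _|_] /=; [apply: B_X|].
- rewrite big_ord_recl unlift_none; under eq_bigr do rewrite liftK.
  by rewrite /= subrK.
rewrite big_ord_recl unlift_none; under eq_bigr do rewrite liftK /= scalerDr.
rewrite big_split /= -scaler_suml scalerBl scale1r mulmx_sum_row.
by rewrite addrA subrK.
Qed.

Lemma tangent_cone_approx d (e : R) : tangent_cone X x d -> 0 < e ->
  exists (t : R) z, [/\ 0 < t, X z & `|t *: (z - x) - d| <= e].
Proof.
move=> Td e0; have := Td _ (nbhsx_ballx d e e0).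
move=> [_ [[t [z [t0 Xz ->]]]]]; rewrite -ball_normE /ball_ /= => /ltW tz.
by exists t, z; split => //; rewrite distrC.
Qed.

(** The row space of [B] contains the feasible directions and is closed. *)
Lemma tangent_cone_sub d : tangent_cone X x d -> (d <= B)%MS.
Proof.
move=> Td; rewrite submxE -normr_le0; apply: (@le0_invn _ _ (n%:R * `|cokermx B|)) => N.
have [|t [z [t0 Xz tz]]] := @tangent_cone_approx d N.+1%:R^-1 Td.
  by rewrite invr_gt0 ltr0Sn.
have zB : (z - x) *m cokermx B = 0 by apply/eqP; rewrite -submxE B_span.
have -> : d *m cokermx B = - ((t *: (z - x) - d) *m cokermx B).
  by rewrite mulmxBl -scalemxAl zB scaler0 sub0r opprK.
rewrite normrN (le_trans (normr_mulmx _ _))// mulrAC ler_wpM2l ?mulr_ge0//.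
Qed.

(** If [J] maps the tangent cone onto the image of the whole direction space,
  some tangent [l] compensates the image of [xh - x]. It is approximated by
  [t *: (z - x)] with [z] in [X], and the remaining error is absorbed by moving
  [xh] slightly, to [xh - q *m B]. The weighted mean of this point and [z], with
  weights proportional to 1 and [t], is then the required point; it is a relative
  interior point because [xh - q *m B] is one. *)
Lemma interior_kernel_point (p : nat) (J : 'M[R]_(n, p)) (xh : 'rV[R]_n) (rho : R) :
  (forall v, (v <= B *m J)%MS -> exists2 d, tangent_cone X x d & d *m J = v) ->
  (xh - x <= B)%MS -> 0 < rho ->
  (forall eta, (eta <= B)%MS -> `|eta| <= rho -> X (xh + eta)) ->
  exists2 x0, (x0 - x <= B)%MS /\ (x0 - x) *m J = 0 &
    exists2 r : R, 0 < r &
      forall eta, (eta <= B)%MS -> `|eta| <= r -> X (x0 + eta).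
Proof.
move=> surj xhB rho0 xhX.
have [C [g [C0 g0 sol]]] := bounded_solution (B *m J).
have [|l Tl lJ] := surj (- ((xh - x) *m J)).
  by rewrite eqmx_opp submxMr.
pose Q := m%:R * (C * (n%:R * `|J|)) * `|B|.
have Q0 : 0 <= Q by rewrite !mulr_ge0.
pose e := rho / 2 / (Q + 1).
have e0 : 0 < e by rewrite !divr_gt0// ltr_wpDl.
have [t [z [t0 Xz tz]]] := tangent_cone_approx Tl e0.
pose v := (t *: (z - x) - l) *m J.
have vE : v = (t *: (z - x) + (xh - x)) *m J by rewrite /v mulmxBl lJ opprK -mulmxDl.
have vB : (v <= B *m J)%MS.
  by rewrite vE submxMr// addmx_sub// scalemx_sub// B_span.
have [|q qv qC] := sol (B *m J) v _ erefl vB.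
  by rewrite subrr normr0 ltW.
have qB : `|q *m B| <= rho / 2.
  apply: (@le_trans _ _ (e * Q)); last first.
    rewrite /e mulrAC ler_pdivrMr ?ltr_wpDl// mulrDr mulr1 lerDl.
    by rewrite divr_ge0// ltW.
  apply: (le_trans (normr_mulmx _ _)).
  have -> : e * Q = m%:R * (C * (n%:R * e * `|J|)) * `|B| by rewrite /Q; ring.
  rewrite ler_wpM2r// ler_wpM2l// (le_trans qC)// ler_wpM2l//.
  by rewrite (le_trans (normr_mulmx _ _))// ler_wpM2r// ler_wpM2l.
pose s := (1 + t)^-1.
have t1 : 0 < 1 + t by rewrite addr_gt0.
have s0 : 0 < s by rewrite invr_gt0.
have s1 : s <= 1 by rewrite invf_le1// lerDl ltW.
pose x0 := s *: (xh - q *m B) + (1 - s) *: z.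
have x0x : x0 - x = s *: ((t *: (z - x) + (xh - x)) - q *m B).
  have st : s * t = 1 - s by rewrite /s; field; rewrite gt_eqF.
  have -> : s *: (t *: (z - x) + (xh - x) - q *m B) =
      (s * t) *: (z - x) + s *: (xh - x - q *m B).
    by rewrite -addrA scalerDr scalerA.
  rewrite st /x0; move: (q *m B) => w.
  by apply/rowP => i; rewrite !mxE; ring.
exists x0.
  split.
    rewrite x0x scalemx_sub// addmx_sub ?eqmx_opp ?submxMl// addmx_sub//.
    by rewrite scalemx_sub// B_span.
  by rewrite x0x -scalemxAl mulmxBl -vE -mulmxA qv subrr scaler0.
exists (s * (rho / 2)); first by rewrite mulr_gt0// divr_gt0.
move=> eta etaB etar.
have -> : x0 + eta = s *: (xh + (s^-1 *: eta - q *m B)) + (1 - s) *: z.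
  rewrite /x0 addrAC; congr (_ + _).
  rewrite -[eta in LHS]scale1r -(divff (lt0r_neq0 s0)) -scalerA -scalerDr.
  by congr (_ *: _); rewrite addrAC addrA.
apply: convex_set_comb => //; last exact: ltW.
apply: xhX; first by rewrite addmx_sub ?eqmx_opp ?submxMl// scalemx_sub.
rewrite (le_trans (ler_normB _ _))// (splitr rho) lerD//.
by rewrite normrZ gtr0_norm ?invr_gt0// ler_pdivrMl.
Qed.

End TangentCone.

Section Dimension.
Context {R : realType} {n : nat}.

Lemma has_dim_subset_eq (S T : set 'rV[R]_n) (r : nat) :
  has_dim S r -> has_dim T r -> S `<=` T -> S = T.
Proof.
move=> [V [-> dV]] [W [-> dW]] VW; suff -> : V = W by [].
by apply/eqP; rewrite eqEdim dV dW leqnn andbT; apply/subvP => v /VW.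
Qed.

End Dimension.

(** * Gradient of the penalised objective *)

Section Gradient.
Context {R : realType} {n p : nat}.

Lemma diff_dot_grad (f : 'rV[R]_n -> R) (x v : 'rV[R]_n) :
  differentiable f x -> 'd f x v = dot v (grad f x).
Proof.
move=> df; rewrite {1}(row_sum_delta v) linear_sum.
by apply: eq_bigr => i _; rewrite linearZ /= -deriveE// mxE.
Qed.

Lemma grad_comp (f : 'rV[R]_n -> R) (A : 'rV[R]_n -> 'rV[R]_n) (x : 'rV[R]_n) :
  differentiable A x -> differentiable f (A x) ->
  grad (f \o A) x = grad f (A x) *m ('J A x)^T.
Proof.
move=> dA df; apply/rowP => i; rewrite !mxE deriveE; last exact: differentiable_comp.
rewrite diff_comp//= diff_dot_grad// -[_ _ (delta_mx 0 i)]deriveE// deriveEjacobian//.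
by rewrite -rowE; apply: eq_bigr => j _; rewrite [grad f _]lock !mxE mulrC.
Qed.

Lemma is_derive_sum_sqr (V : normedModType R) (g : 'I_p -> V -> R) (x v : V) :
  (forall i, derivable (g i) x v) -> (forall i, g i x = 0) ->
  is_derive x v (\sum_(i < p) (g i ^+ 2)) 0.
Proof.
move=> dg g0.
have dg2 i : is_derive x v (g i ^+ 2) 0.
  have dgi := derivableP (dg i).
  by have := is_deriveX 2 dgi; rewrite g0 expr1 mulr0 scale0r.
have s0 : \sum_(i < p) (0 : R) = 0 by rewrite big1.
by have := is_derive_sum dg2; rewrite s0.
Qed.

Lemma derive_add_critical (V : normedModType R) (g s : V -> R) (k : R) (x v : V) :
  derivable g x v -> is_derive x v s 0 -> 'D_v (g + k *: s) x = 'D_v g x.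
Proof.
move=> dg [ds Ds].
by rewrite deriveD//; [rewrite deriveZ// Ds scaler0 addr0|exact: derivableZ].
Qed.

(** The penalty is quadratic in [c], hence critical at the zeros of [c]. *)
Lemma grad_cdp_obj (f : 'rV[R]_n -> R) (c : 'rV[R]_n -> 'rV[R]_p)
    (A : 'rV[R]_n -> 'rV[R]_n) (beta : R) (x : 'rV[R]_n) :
  differentiable A x -> differentiable f (A x) -> differentiable c x -> c x = 0 ->
  grad (cdp_obj f c A beta) x = grad f (A x) *m ('J A x)^T.
Proof.
move=> dA df dc cx0; rewrite -grad_comp//.
have -> : cdp_obj f c A beta =
    (f \o A) + (beta / 2) *: (\sum_(i < p) ((fun y => c y 0 i) ^+ 2)).
  apply/funext => y; rewrite /cdp_obj; congr (_ + _).
  rewrite /enorm sqr_sqrtr; last by apply: sumr_ge0 => i _; rewrite -expr2 sqr_ge0.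
  by rewrite /dot fct_sumE; congr (_ * _); apply: eq_bigr => i _; rewrite -expr2.
apply/rowP => i; rewrite !mxE; set v := delta_mx 0 i.
have dfA : derivable (f \o A) x v by apply/diff_derivable/differentiable_comp.
have dcx : derivable c x v by exact: diff_derivable.
have dcj j : derivable (fun y => c y 0 j) x v by move/derivable_mxP : dcx; apply.
have c0 j : c x 0 j = 0 by rewrite cx0 mxE.
have dsqr := is_derive_sum_sqr dcj c0.
exact: derive_add_critical dfA dsqr.
Qed.

End Gradient.

(** * Equivalence of the stationarity conditions *)

Section Stationarity.
Context {R : realType} {n p : nat}.
Variables (X Y : set 'rV[R]_n) (f : 'rV[R]_n -> R) (c : 'rV[R]_n -> 'rV[R]_p).
Hypothesis X_closed : closed X.
Hypothesis X_convex : convex_set X.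
Hypothesis Y_open : open Y.
Hypothesis XY : X `<=` Y.
Hypothesis fcX_regular : regular_data X Y f c.

(** The derivative of [A] at [x] fixes [x0 + eta - x] for all small [eta] in the
  kernel of the derivative of [c], in particular for [eta = 0]; subtracting, it
  fixes [eta], and by homogeneity every element of the kernel. *)
Lemma feasible_tangent_fixed (x : 'rV[R]_n) (A : 'rV[R]_n -> 'rV[R]_n) :
  feasible X c x -> differentiable A x ->
  (forall z, feasible X c z -> A z = z) ->
  exists (m : nat) (B : 'M[R]_(m, n)),
    (forall z, X z -> (z - x <= B)%MS) /\
    forall u : 'rV[R]_m, u *m (B *m 'J c x) = 0 -> u *m B *m 'J A x = u *m B.
Proof.
move=> Kx dA AK; have [Xx _] := Kx.
have [_ + [r r0 /(_ x Kx)[tau tau0 [rank_aff rank_lin]]]] := fcX_regular.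
move: rank_aff rank_lin.
(* makes the Jacobian opaque to unification *)
have [J JE] : exists J, jacobian c = J by exists (jacobian c).
rewrite !JE => rank_aff rank_lin c_smooth.
have [m [B [Bfree B_X B_span]]] := affine_frame Xx.
exists m, B; split => //.
have imE z : [set d *m J z | d in aff_dir X x] = [set v | (v <= B *m J z)%MS].
  rewrite (aff_dirE Xx B_X B_span); apply/seteqP; split=> v /=.
    by move=> [d dB <-]; apply: submxMr.
  by move=> /submxP[u ->]; exists (u *m B); rewrite /= ?submxMl// mulmxA.
have aff_X z : X z -> aff X z.
  move=> Xz; exists 1%N, (fun=> 1), (fun=> z).
  by rewrite !big_ord1 scale1r.
have rankB z : X z -> enorm (z - x) <= tau -> \rank (B *m J z) = r.
  by move=> Xz zx; apply: has_dim_rank; rewrite -imE; apply: rank_aff; auto.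
have xx0 : enorm (x - x) <= tau.
  by rewrite subrr (le_trans (enorm_le _))// normr0 mulr0 ltW.
(* the rank condition is stated with the Euclidean norm *)
pose tau' := tau / (n%:R + 1).
have tau'0 : 0 < tau' by rewrite divr_gt0// ltr_wpDl.
have constant_rank z : X z -> `|z - x| <= tau' ->
    \rank (B *m J z) = \rank (B *m J x).
  move=> Xz zx; rewrite (rankB x Xx xx0); apply: (rankB z Xz).
  apply: (le_trans (enorm_le _)).
  apply: (@le_trans _ _ (n%:R * tau')); first by rewrite ler_wpM2l.
  rewrite mulrC /tau' mulrAC ler_pdivrMr ?ltr_wpDl//.
  by rewrite mulrDr mulr1 lerDl ltW.
have surj v : (v <= B *m J x)%MS ->
    exists2 d, tangent_cone X x d & d *m J x = v.
  (* both images have dimension r, and the first is contained in the second *)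
  have imL : [set d *m J x | d in lineality X x] = [set d *m J x | d in aff_dir X x].
    apply: has_dim_subset_eq (rank_lin x Xx xx0)
      (rank_aff x (XY Xx) (aff_X x Xx) xx0) _.
    rewrite imE => _ [d [Td _] <-] /=; apply: submxMr.
    exact: tangent_cone_sub B_span _ Td.
  move=> vB; have : [set v | (v <= B *m J x)%MS] v by [].
  by rewrite -imE -imL => -[d [Td _] <-]; exists d.
have [xh [Xxh xhB] [rho rho0 xhX]] := relative_interior X_convex Xx Bfree B_X.
have [x0 [x0B x0J] [r' r'0 x0X]] :=
  interior_kernel_point X_convex B_span surj xhB rho0 xhX.
have fix_near eta : (eta <= B)%MS -> `|eta| <= r' / 2 -> eta *m J x = 0 ->
    (x0 + eta - x) *m 'J A x = x0 + eta - x.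
  move=> etaB etar etaJ.
  have r'2 : 0 < r' / 2 by rewrite divr_gt0.
  apply: (fixed_direction X_closed X_convex Y_open XY (J := J) (fun=> congr1 (@^~ _) JE)
    c_smooth Kx B_span tau'0 constant_rank r'2) => //.
  - by rewrite addrAC addmx_sub.
  - move=> y yB yr; rewrite -addrA; apply: x0X; first exact: addmx_sub.
    by rewrite (splitr r') (le_trans (ler_normD _ _))// lerD.
  - by rewrite addrAC mulmxDl x0J etaJ addr0.
move=> u; rewrite mulmxA; set w := u *m B => wJ.
have wB : (w <= B)%MS by exact: submxMl.
pose s := r' / 2 / (`|w| + 1).
have s0 : 0 < s by rewrite !divr_gt0// ltr_wpDl.
have fix0 : (x0 - x) *m 'J A x = x0 - x.
  have := fix_near 0; rewrite addr0; apply; rewrite ?sub0mx ?mul0mx//.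
  by rewrite normr0 ltW// divr_gt0.
have : (x0 + s *: w - x) *m 'J A x = x0 + s *: w - x.
  apply: fix_near; first exact: scalemx_sub.
    rewrite normrZ gtr0_norm// /s mulrAC ler_pdivrMr ?ltr_wpDl//.
    by rewrite ler_pM2l ?divr_gt0// lerDl.
  by rewrite -scalemxAl wJ scaler0.
rewrite addrAC mulmxDl fix0 => /addrI.
by rewrite -scalemxAl => /(scalerI (lt0r_neq0 s0)).
Qed.

End Stationarity.

Theorem theorem3p8 (R : realType) (n p : nat) (X Y : set 'rV[R]_n)
    (f : 'rV[R]_n -> R) (c : 'rV[R]_n -> 'rV[R]_p)
    (A : 'rV[R]_n -> 'rV[R]_n) (beta : R)
    (X_closed : closed X) (X_convex : convex_set X)
    (Y_open : open Y) (XY : X `<=` Y)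
    (fcX_regular : regular_data X Y f c)
    (A_cdm : constraint_dissolving X c A)
    (beta_ge0 : 0 <= beta) (x : 'rV[R]_n) (Kx : feasible X c x) :
  cdp_stationary X f c A beta x <-> ncp_stationary X f c x.
Proof.
have [Xx cx0] := Kx.
have [[f_diff _ _] [c_diff _ _] _] := fcX_regular.
have [[A_diff _ _] A_K [RA [_ RA0 /(_ x Kx)[omega omega0 A_normal]]]] := A_cdm.
have [Ax JAc] := A_K x Kx.
have gradE : grad (cdp_obj f c A beta) x = grad f x *m ('J A x)^T.
  rewrite grad_cdp_obj ?Ax//; [exact: A_diff|exact: f_diff|exact/c_diff/XY].
have normalE v : normal_cone X x v -> v *m ('J A x)^T = v.
  move=> Nv; have := A_normal x v Xx _ Nv.
  rewrite RA0// subr0 linearB /= trmx1 mulmxBr mulmx1 => H; apply/subr0_eq/H.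
  by rewrite subrr (le_trans (enorm_le _))// normr0 mulr0 ltW.
have rangeE (l : 'rV[R]_p) : l *m ('J c x)^T *m ('J A x)^T = 0.
  by rewrite -mulmxA -trmx_mul JAc trmx0 mulmx0.
have [m [B [B_span fixB]]] := feasible_tangent_fixed X_closed X_convex Y_open XY fcX_regular
  Kx (A_diff x Xx) (fun z Kz => (A_K z Kz).1).
have kerJA (w : 'rV[R]_n) : w *m ('J A x)^T = 0 -> exists l, w = l *m ('J c x)^T.
  move=> wJ.
  have JAw : 'J A x *m w^T = 0.
    by apply: trmx_inj; rewrite trmx_mul trmxK wJ trmx0.
  have : (w *m B^T <= (B *m 'J c x)^T)%MS.
    apply: mulmx_ker_colspace => u /fixB uB.
    by rewrite trmx_mul trmxK mulmxA -uB -[_ *m w^T]mulmxA JAw mulmx0.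
  move=> /submxP[l wl]; exists l; apply/subr0_eq.
  set s := w - _.
  have sB : s *m B^T = 0 by rewrite mulmxBl wl trmx_mul mulmxA subrr.
  rewrite -(normalE s) ?mulmxBl ?wJ ?rangeE ?subrr//.
  move=> z /B_span /submxP[u ->].
  by rewrite dot_mulmx trmx_mul mulmxA sB mul0mx mxE.
split=> [[_ [v Nv]]|[_ [u [v [[l _ <-] Nv E]]]]].
  rewrite gradE -(normalE v Nv) -mulmxDl => /esym/kerJA[l wl].
  split=> //; exists (- l *m ('J c x)^T), v; split => //; first by exists (- l).
  by rewrite addrAC wl mulNmx subrr.
split=> //; exists v => //.
by rewrite gradE -(normalE v Nv) -mulmxDl -[LHS](mul0mx _ ('J A x)^T) E
  !mulmxDl rangeE addr0.
Qed.
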